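(* Let $s\in S$ be a boundary point of the moment cone $S\subseteq\mathbb{R}^m$. Then $V_+(s)=W(s)$ if and only if $s$ lies in the relative interior of an exposed face of the moment cone $S$.
   Context: $\mathcal X$ is a locally compact Hausdorff space, $E$ is a finite-dimensional vector space of real-valued continuous functions on $\mathcal X$, and $\{f_1,\dots,f_m\}$ is a fixed vector space basis of $E$. A Radon measure on $\mathcal X$ is a (nonnegative) measure $\mu$ on the Borel $\sigma$-algebra with values in $[0,+\infty]$ such that $\mu(M)=\sup\{\mu(K):K\subseteq M,\ K\text{ compact}\}$ for every Borel set $M$. For $s=(s_1,\dots,s_m)\in\mathbb{R}^m$ let $L_s$ be the linear functional on $E$ with $L_s(f_j)=s_j$. The vector $s$ is a moment sequence if there is a Radon measure $\mu$ on $\mathcal X$ such that all $f\in E$ are $\mu$-integrable and $s_j=\int f_j\,d\mu$ for $j=1,\dots,m$; such $\mu$ is called a representing measure of $s$, and $\mathcal M_s$ is the set of all of them. The moment cone $S\subseteq\mathbb{R}^m$ is the set of all moment sequences. Put $E_+=\{f\in E:f(x)\ge 0\text{ for all }x\in\mathcal X\}$. For $s\in S$ define $N_+(s)=\{f\in E_+:L_s(f)=0\}$, $V_+(s)=\{x\in\mathcal X:f(x)=0\text{ for all }f\in N_+(s)\}$, $W(s)=\{x\in\mathcal X:\mu(\{x\})>0\text{ for some }\mu\in\mathcal M_s\}$. For $u\in\mathbb{R}^m$, $u\neq 0$, let $H_u=\{t\in\mathbb{R}^m:\langle t,u\rangle=0\}$ (standard scalar product). $H_u$ is a supporting hyperplane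 of $S$ at a point $s\in S$ if $\langle s,u\rangle=0$ and $\langle t,u\rangle\ge0$ for all $t\in S$; in that case $H_u\cap S$ is called a proper exposed face of $S$. By definition $S$ and $\emptyset$ are also exposed faces of $S$. *)

(* Defs.v *)
From HB Require Import structures.
From mathcomp Require Import all_boot all_order all_algebra.
From mathcomp Require Import all_classical all_reals all_analysis.

Set Implicit Arguments.
Unset Strict Implicit.
Unset Printing Implicit Defensive.

Import Order.TTheory GRing.Theory Num.Theory.
Import numFieldNormedType.Exports.

Local Open Scope classical_set_scope.
Local Open Scope ring_scope.

(* [ptopologicalType] rather than [topologicalType] because measurable types
   are pointed in the library; the chosen point plays no role. *)
Definition borel (X : ptopologicalType) := g_sigma_algebraType (@open X).

(* Inner regular by compact sets. Compact sets are closed, hence Borel, when X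
   is Hausdorff. No finiteness on compact sets is required. *)
Definition radon (R : realType) (X : ptopologicalType)
    (mu : {measure set (borel X) -> \bar R}) :=
  forall M : set (borel X), measurable M ->
    mu M = ereal_sup [set mu K | K in [set K : set X | K `<=` M /\ compact K]].

Section FiniteDimensionalSpace.
Variables (R : realType) (X : ptopologicalType) (m : nat).
Implicit Types (E : set (X -> R)) (f : 'I_m -> X -> R) (c s : 'rV[R]_m).

Definition lincomb f c : X -> R := \sum_(j < m) c 0 j *: f j.

Definition is_basis E f :=
  E = range (lincomb f) /\ (forall c, lincomb f c = 0 -> c = 0).

(* Coordinates of g in the family f; junk if g is not in its span. *)
Definition coords f (g : X -> R) : 'rV[R]_m :=
  xget 0 [set c | lincomb f c = g].

(* The linear functional on E taking the value s_j at f_j, see [Lfun_basis]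
   and [Lfun_linear] *)
Definition Lfun f s (g : X -> R) : R := \sum_(j < m) coords f g 0 j * s 0 j.

Definition representing E f s (mu : {measure set (borel X) -> \bar R}) :=
  [/\ radon mu,
      (forall g, E g -> mu.-integrable [set: borel X] (EFin \o g)) &
      (forall j, (s 0 j)%:E = \int[mu]_x (f j x)%:E)%E].

Definition moment_cone E f : set 'rV[R]_m :=
  [set s | exists mu, representing E f s mu].

Definition nonneg_part E : set (X -> R) := [set g | E g /\ forall x, 0 <= g x].

Definition N_plus E f s : set (X -> R) :=
  [set g | nonneg_part E g /\ Lfun f s g = 0].

Definition V_plus E f s : set X :=
  [set x | forall g, N_plus E f s g -> g x = 0].

Definition atoms E f s : set X :=
  [set x | exists2 mu, representing E f s mu & (0 < mu [set x])%E].

Lemma coords_lincomb E f c : is_basis E f -> coords f (lincomb f c) = c.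
Proof.
move=> [_ free]; rewrite /coords; case: xgetP => [d _ /= dc|/(_ c) /(_ erefl)//].
apply/eqP; rewrite -subr_eq0; apply/eqP/free; rewrite /lincomb.
under eq_bigr do rewrite !mxE scalerBl.
by rewrite sumrB -/(lincomb f d) dc subrr.
Qed.

Lemma Lfun_basis E f s j : is_basis E f -> Lfun f s (f j) = s 0 j.
Proof.
move=> fE; have -> : f j = lincomb f (delta_mx 0 j).
  rewrite /lincomb (bigD1 j)//= mxE !eqxx scale1r big1 ?addr0// => i ij.
  by rewrite mxE eqxx (negbTE ij) scale0r.
rewrite /Lfun (coords_lincomb _ fE) (bigD1 j)//= mxE !eqxx mul1r big1 ?addr0//.
by move=> i ij; rewrite mxE eqxx (negbTE ij) mul0r.
Qed.

Lemma Lfun_linear E f s (a : R) g h : is_basis E f -> E g -> E h ->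
  Lfun f s (a *: g + h) = a * Lfun f s g + Lfun f s h.
Proof.
move=> fE; have [-> _] := fE => -[c _ <-] [d _ <-].
have -> : a *: lincomb f c + lincomb f d = lincomb f (a *: c + d).
  rewrite /lincomb scaler_sumr -big_split/=.
  by apply: eq_bigr => j _; rewrite !mxE scalerDl scalerA.
rewrite /Lfun !(coords_lincomb _ fE) mulr_sumr -big_split/=.
by apply: eq_bigr => j _; rewrite !mxE mulrDl mulrA.
Qed.

End FiniteDimensionalSpace.

Section ConvexGeometry.
Variables (R : realType) (m : nat).
Implicit Types (C F S : set 'rV[R]_m) (s t u : 'rV[R]_m).

Definition boundary C := closure C `\` interior C.

Definition affine_hull C : set 'rV[R]_m :=
  [set t | exists n (a : 'I_n -> R) (p : 'I_n -> 'rV[R]_m),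
    [/\ forall i, C (p i), \sum_i a i = 1 & t = \sum_i a i *: p i]].

Definition relative_interior C : set 'rV[R]_m :=
  [set t | C t /\ \forall y \near t, affine_hull C y -> C y].

Definition dot s t : R := \sum_(j < m) s 0 j * t 0 j.

Definition hyperplane u : set 'rV[R]_m := [set t | dot t u = 0].

Definition supporting S u s :=
  [/\ u != 0, S s, dot s u = 0 & forall t, S t -> 0 <= dot t u].

Definition exposed_face S F :=
  [\/ F = S, F = set0 |
      exists u s, supporting S u s /\ F = hyperplane u `&` S].

End ConvexGeometry.

(* Main.v *)
(* Write e(x) = (f_1(x), ..., f_m(x)), the moment vector of the Dirac measure at
   x, and f_u = sum_j u_j f_j, so that f_u(x) = <e(x), u>.

   If s lies in the relative interior of an exposed face F and x is in V_+(s),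
   then e(x) is in F, so the segment from e(x) to s can be prolonged beyond s
   inside F; hence s has a representing measure with an atom at x.

   Conversely, N_+(s) contains some f_u whose zero set is exactly V_+(s) (the
   sum of a finite spanning subset of N_+(s)).  A measure representing a point
   of F = H_u /\ S lives on the zeros of f_u, so F is contained in the span of
   the e(x) with x in V_+(s).  If V_+(s) = W(s), each such x is an atom of some
   representing measure of s, and removing this atom shows that s - eps e(x) is
   in S for some eps > 0.  As F is spanned by finitely many of the e(x), s is a
   relative interior point of F.  When u = 0, F is S itself. *)

Require Import Defs.
From mathcomp Require Import all_boot all_order all_algebra.
From mathcomp Require Import all_classical all_reals all_analysis.
From mathcomp Require Import measurable_realfun lra.
Import Order.TTheory GRing.Theory Num.Theory.
Import numFieldNormedType.Exports.

Set Implicit Arguments.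
Unset Strict Implicit.
Unset Printing Implicit Defensive.

Local Open Scope classical_set_scope.
Local Open Scope ring_scope.

(** * Linear algebra and convex cones: spans, hyperplane sections, relative interiors *)

Section Convexity.
Variables (R : realType) (m : nat).
Implicit Types (A S : set 'rV[R]_m) (s t u v : 'rV[R]_m).

Lemma dotE s u : dot s u = (s *m u^T) 0 0.
Proof. by rewrite mxE; apply: eq_bigr => j _; rewrite mxE. Qed.

Lemma dotC s t : dot s t = dot t s.
Proof. by apply: eq_bigr => j _; rewrite mulrC. Qed.

Lemma dotZl (a : R) s u : dot (a *: s) u = a * dot s u.
Proof. by rewrite !dotE -scalemxAl mxE. Qed.

Lemma dot_suml n (p : 'I_n -> 'rV[R]_m) u :
  dot (\sum_i p i) u = \sum_i dot (p i) u.
Proof.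
by rewrite dotE mulmx_suml summxE; under eq_bigr do rewrite -dotE.
Qed.

(** Take a matrix of maximal rank among those with rows in [A]. Appending another element of [A]
    cannot raise the rank, so that element already lies in the row space. *)
Lemma finite_spanning_family A : exists n (M : 'M[R]_(n, m)),
  (forall i, A (row i M)) /\ (forall a, A a -> (a <= M)%MS).
Proof.
pose P k := `[< exists n (M : 'M[R]_(n, m)),
  (forall i, A (row i M)) /\ \rank M = k >].
have P0 : exists k, P k.
  by exists 0%N; apply/asboolP; exists 0%N, 0; split; [case|rewrite mxrank0].
have Pm k : P k -> (k <= m)%N.
  by move=> /asboolP[n [M [_ <-]]]; exact: rank_leq_col.
case: (ex_maxnP P0 Pm) => k /asboolP[n [M [AM rM]]] maxk.
exists n, M; split=> // a Aa.
have /maxk : P (\rank (col_mx M a)).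
  apply/asboolP; exists (n + 1)%N, (col_mx M a); split=> // i.
  by rewrite -(splitK i); case: (fintype.split i) => j /=;
    rewrite ?rowKu ?rowKd ?row_id.
rewrite -rM => rk.
have aMa : (a <= col_mx M a)%MS by rewrite -addsmxE addsmxSr.
apply: submx_trans aMa _.
by rewrite -(geq_leqif (mxrank_leqif_sup _)) // -addsmxE addsmxSl.
Qed.

(** The columns of [cokermx M] are orthogonal to every row of [M], and [t] is in the row space as
    soon as it is orthogonal to these columns. *)
Lemma dot_separates n (M : 'M[R]_(n, m)) t :
  (forall v, (forall i, dot (row i M) v = 0) -> dot t v = 0) -> (t <= M)%MS.
Proof.
move=> tM; rewrite submxE; apply/eqP/rowP => j.
have colE (v : 'rV_m) : dot v (col j (cokermx M))^T = (v *m cokermx M) 0 j.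
  by rewrite mxE; apply: eq_bigr => k _; rewrite !mxE.
rewrite -colE mxE; apply: tM => i.
by rewrite colE -row_mul mulmx_coker !mxE.
Qed.

Variable S : set 'rV[R]_m.
Hypothesis S_add : forall s t, S s -> S t -> S (s + t).
Hypothesis S_scale : forall (a : R) s, 0 < a -> S s -> S (a *: s).

(* Writing [y - s] as [\sum_i c_i p_i], the point [(n + 1) y] is the sum of [s]
   and the points [s + (n + 1) c_i p_i], all in [S] once the [c_i] are small. *)
Lemma cone_near_span n (M : 'M[R]_(n, m)) s : S s ->
  (forall i, S (row i M)) ->
  (forall i, exists2 e : R, 0 < e & S (s - e *: row i M)) ->
  \forall y \near s, (y <= M)%MS -> (s <= M)%MS -> S y.
Proof.
move=> Ss SM SsM.
(* Coordinates of [y - s] with respect to the rows of [M], through the pseudo-inverse: they are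
   continuous in [y] and vanish at [s]. *)
pose c (y : 'rV[R]_m) i := ((y - s) *m pinvmx M) 0 i.
(* Even a negative [d] is allowed: starting from [s - e *: row i M], the coefficient still to be
   added is [d + e > 0]. *)
have absorb i (e : R) d : 0 < e -> S (s - e *: row i M) -> `|d| < e ->
    S (s + d *: row i M).
  move=> e0 Se; rewrite ltr_norml => /andP[ed _].
  have -> : s + d *: row i M = (s - e *: row i M) + (d + e) *: row i M.
    by rewrite scalerDl addrACA addNr addr0.
  by apply: S_add => //; apply: S_scale => //; rewrite -ltrBlDr sub0r.
have near_c : \forall y \near s, forall i, S (s + (n.+1%:R * c y i) *: row i M).
  apply: (@filter_forall _ _
    (fun i y => S (s + (n.+1%:R * c y i) *: row i M)) (nbhs s)) => i.
  have [e e0 Se] := SsM i.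
  have cE y : c y i = \sum_(j < m) (y 0 j - s 0 j) * pinvmx M j i.
    by rewrite /c mxE; apply: eq_bigr => j _; congr (_ * _); rewrite !mxE.
  have lim0 : (fun y : 'rV[R]_m => \sum_(j < m) (y 0 j - s 0 j) * pinvmx M j i)
      @ s --> (0 : R).
    have sum0 : \sum_(j < m) (s 0 j - s 0 j) * pinvmx M j i = 0.
      by rewrite big1// => j _; rewrite subrr mul0r.
    rewrite -[X in _ --> X]sum0.
    apply: (cvg_big add_continuous (nbhs_filter s)) => j _.
    apply: cvgMr_tmp; apply: cvgB; last exact: cvg_cst.
    exact: coord_continuous.
  have en0 : 0 < n.+1%:R^-1 * e by rewrite mulr_gt0 ?invr_gt0 ?ltr0n.
  apply: filterS (cvgr0_norm_lt _ lim0 _ en0) => y; rewrite -cE => ye.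
  apply: absorb e0 Se _; rewrite normrM normr_nat.
  by rewrite -ltr_pdivlMl ?ltr0n.
apply: filterS near_c => y Sy yM sM.
have ysM : (y - s <= M)%MS by rewrite addmx_sub // eqmx_opp.
have -> : y = n.+1%:R^-1 *:
    (s + \sum_(i < n) (s + (n.+1%:R * c y i) *: row i M)).
  under eq_bigr do rewrite -scalerA.
  rewrite big_split /= -scaler_sumr -mulmx_sum_row mulmxKpV //.
  rewrite sumr_const card_ord addrA -mulrS.
  rewrite -[s *+ _]scaler_nat -scalerDr addrC subrK.
  by rewrite scalerA mulVf ?scale1r// pnatr_eq0.
apply: S_scale; first by rewrite invr_gt0 ltr0n.
by elim/big_rec: _ => [|i t _ St]; rewrite ?addr0// addrCA; exact: S_add.
Qed.

(** The affine hull of the face stays in the hyperplane and in the row space of [M], and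
    [cone_near_span] puts the points of that row space close to [s] into [S]. *)
Lemma relative_interior_face n (M : 'M[R]_(n, m)) s u : S s -> dot s u = 0 ->
  (forall i, S (row i M)) ->
  (forall i, exists2 e : R, 0 < e & S (s - e *: row i M)) ->
  (forall t, S t -> dot t u = 0 -> (t <= M)%MS) ->
  relative_interior (hyperplane u `&` S) s.
Proof.
move=> Ss su SM SsM SuM; split=> //.
apply: filterS (cone_near_span Ss SM SsM) => y Sy [k [a [p [pF _ yE]]]].
split.
  rewrite /hyperplane /= yE dot_suml big1// => i _.
  by rewrite dotZl (pF i).1 mulr0.
apply: Sy; last exact: SuM.
rewrite yE summx_sub// => i _; apply: scalemx_sub.
by have [? ?] := pF i; exact: SuM.
Qed.

(** The point [s + e *: (s - t)] is the affine combination of [s] and [t] with coefficients [1 + e]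
    and [- e], and it tends to [s] as [e] tends to 0. *)
Lemma relative_interior_absorb A s t : relative_interior A s -> A t ->
  exists2 e : R, 0 < e & A (s + e *: (s - t)).
Proof.
move=> [As sA] At.
have lim : (fun e : R => s + e *: (s - t)) @ (0 : R) --> s.
  have s0 : s + 0 *: (s - t) = s by rewrite scale0r addr0.
  rewrite -[X in _ --> X]s0.
  by apply: cvgD; [exact: cvg_cst|apply: cvgZr_tmp].
have /nbhs_ballP[d /= d0 dA] := lim _ sA.
exists (d / 2); first by rewrite divr_gt0.
apply: dA.
  by rewrite -ball_normE /= sub0r normrN gtr0_norm ?divr_gt0//
    ltr_pdivrMr// ltr_pMr// ltr1n.
exists 2%N, (fun i => if i == 0 then 1 + d / 2 else - (d / 2)),
  (fun i => if i == 0 then s else t); split.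
- by move=> i; case: ifP.
- by rewrite !big_ord_recl big_ord0 /= addr0 addrK.
- rewrite !big_ord_recl big_ord0 /= addr0 scalerDl scale1r scaleNr scalerBr.
  by rewrite addrA.
Qed.

End Convexity.

(** * Radon measures and the operations that preserve them *)

Lemma lte_add_split (R : realType) (a x y : \bar R) :
  (0 <= x)%E -> (0 <= y)%E -> (a < x + y)%E ->
  exists b c : R, [/\ (b%:E < x)%E, (c%:E < y)%E & (a <= (b + c)%:E)%E].
Proof.
have neg1 (z : \bar R) : (0 <= z)%E -> ((-1)%:E < z)%E.
  by apply: lt_le_trans; rewrite lte_fin ltrN10.
case: a => [a| |] x0 y0; last 2 first.
- by rewrite ltNge leey.
- by exists (-1), (-1); split; rewrite ?neg1// leNye.
(* If both terms are finite, each gives up half of the excess [x + y - a]. Otherwise an infinite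
   term takes the bound [a + 1], and the other takes [-1], which lies below every nonnegative
   value. *)
case: x x0 => [x| |] // x0; case: y y0 => [y| |] // y0 axy.
- exists (x - (x + y - a) / 2), (y - (x + y - a) / 2).
  by move: axy; rewrite -EFinD !lte_fin lee_fin => axy; split; lra.
- by exists (-1), (a + 1); rewrite neg1// ltry lee_fin; split=> //; lra.
- by exists (a + 1), (-1); rewrite neg1// ltry lee_fin; split=> //; lra.
- by exists (a + 1), (-1); rewrite neg1// ltry lee_fin; split=> //; lra.
Qed.

Section RadonMeasures.
Variables (R : realType) (X : ptopologicalType).
Hypothesis X_hausdorff : hausdorff_space X.
Implicit Types mu nu : {measure set (borel X) -> \bar R}.

Lemma compact_borel (K : set X) : compact K -> measurable (K : set (borel X)).
Proof.
move=> /(compact_closed X_hausdorff) Kc.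
rewrite -[K]setCK; apply: (@measurableC _ (borel X)).
by apply: (@sub_sigma_algebra X setT open); exact: closed_openC.
Qed.

Lemma set1_borel (x : X) : measurable ([set x] : set (borel X)).
Proof. exact: compact_borel (@compact_set1 _ x). Qed.

(** Testing the supremum by strict lower bounds treats finite and infinite [mu M] alike. *)
Lemma radonP mu : radon mu <->
  forall M : set (borel X), measurable M -> forall a : \bar R, (a < mu M)%E ->
    exists K : set X, [/\ K `<=` M, compact K & (a < mu K)%E].
Proof.
split=> [muR M mM a|muR M mM].
  by rewrite (muR M mM) => /ereal_sup_gtP[_ [K [KM Kc] <-] aK]; exists K.
apply/eqP; rewrite eq_le; apply/andP; split; last first.
  apply: ge_ereal_sup => _ [K [KM Kc] <-].
  by apply: le_measure; rewrite ?inE//; exact: compact_borel.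
rewrite leNgt; apply/negP => /(muR M mM)[K [KM Kc]].
by apply/negP; rewrite -leNgt; apply: ereal_sup_ubound; exists K.
Qed.

Lemma radon_dirac (x : X) : radon (@dirac _ (borel X) x R).
Proof.
apply/radonP => M mM a aM; have [xM|xM] := pselect (M x).
  exists [set x]; split; [by move=> _ ->|exact: compact_set1|].
  by move: aM; rewrite /= !diracE !mem_set.
exists set0; split; [exact: sub0set|exact: compact0|].
by move: aM; rewrite /= !diracE memNset// memNset.
Qed.

Lemma radon_mscale (r : {nonneg R}) mu : 0 < r%:num -> radon mu ->
  radon (mscale r mu).
Proof.
move=> r0 /radonP muR; apply/radonP => M mM a; rewrite /mscale /=.
rewrite -lte_pdivrMl// => /(muR M mM)[K [KM Kc aK]]; exists K; split=> //.
by rewrite -lte_pdivrMl.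
Qed.

(** A lower bound for the sum splits into one for each measure; the union of the two compact sets
    found for them serves both. *)
Lemma radon_add mu nu : radon mu -> radon nu -> radon (measure_add mu nu).
Proof.
move=> /radonP muR /radonP nuR; apply/radonP => M mM a.
rewrite [ltRHS]measure_addE => aM.
have [b [c [bM cM abc]]] :=
  lte_add_split (measure_ge0 mu M) (measure_ge0 nu M) aM.
have [K [KM Kc bK]] := muR M mM _ bM.
have [L [LM Lc cL]] := nuR M mM _ cM.
exists (K `|` L); split; [by rewrite subUset|exact: compactU|].
have mK := compact_borel Kc; have mL := compact_borel Lc.
have mKL : measurable (K `|` L : set (borel X)) by exact: measurableU.
rewrite [ltRHS]measure_addE; apply: le_lt_trans abc _; rewrite EFinD.
apply: lteD.
- by apply: lt_le_trans bK _; apply: le_measure; rewrite ?inE//; left.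
- by apply: lt_le_trans cL _; apply: le_measure; rewrite ?inE//; right.
Qed.

Lemma radon_mrestr mu (D : set (borel X)) (mD : measurable D) : radon mu ->
  radon (mrestr mu mD).
Proof.
move=> /radonP muR; apply/radonP => M mM a.
move=> /(muR _ (measurableI _ _ mM mD))[K [KMD Kc aK]].
exists K; split=> //; first by move=> x /KMD[].
rewrite [ltRHS](_ : _ = mu (K `&` D))// setIidl// => x /KMD[] //.
Qed.

End RadonMeasures.

(** * Integrals against sums and multiples of measures, infinite atoms, null sets *)

Section IntegralsAndMeasures.
Context d (T : measurableType d) (R : realType).
Implicit Types (mu nu : {measure set T -> \bar R}) (g : T -> \bar R).

Let measurable_abse g : measurable_fun setT g ->
  measurable_fun setT (fun x => `|g x|)%E.
Proof. exact: measurableT_comp (@abse_measurable R setT). Qed.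

Lemma integrable_measure_add mu nu g :
  mu.-integrable setT g -> nu.-integrable setT g ->
  (measure_add mu nu).-integrable setT g.
Proof.
move=> /integrableP[mg mug] /integrableP[_ nug]; apply/integrableP; split=> //.
rewrite ge0_integral_measure_add//; last exact: measurable_abse.
by rewrite lte_add_pinfty.
Qed.

Lemma integrable_measure_addl mu nu g :
  (measure_add mu nu).-integrable setT g -> mu.-integrable setT g.
Proof.
move=> /integrableP[mg]; rewrite ge0_integral_measure_add//; last first.
  exact: measurable_abse.
move=> lty; apply/integrableP; split=> //; apply: le_lt_trans lty.
by rewrite leeDl// integral_ge0.
Qed.

Lemma integrable_mscale (r : {nonneg R}) mu g :
  mu.-integrable setT g -> (mscale r mu).-integrable setT g.
Proof.
move=> /integrableP[mg mug]; apply/integrableP; split=> //.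
rewrite ge0_integral_mscale//; last exact: measurable_abse.
by rewrite lte_mul_pinfty.
Qed.

Lemma integral_mscale (r : {nonneg R}) mu g : mu.-integrable setT g ->
  (\int[mscale r mu]_x g x = r%:num%:E * \int[mu]_x g x)%E.
Proof.
move=> ig; have mg := measurable_int _ ig.
rewrite (integralE mu setT g) (integralE _ setT g).
rewrite (ge0_integral_mscale _ measurableT r (measurable_funepos mg))//.
rewrite (ge0_integral_mscale _ measurableT r (measurable_funeneg mg))//.
by rewrite [RHS]muleBr// integrable_add_def.
Qed.

Lemma integrable_dirac (x : T) (g : T -> R) : measurable_fun setT g ->
  (\d_x : {measure set T -> \bar R}).-integrable setT (EFin \o g).
Proof.
move=> mg; have mEg : measurable_fun setT (EFin \o g) by exact/measurable_EFinP.
apply/integrableP; split=> //.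
rewrite integral_dirac//; last exact: measurable_abse.
by rewrite diracT mul1e ltry.
Qed.

(** Markov's inequality: if [g x] were nonzero, the set where [|g|] is at least [|g x|] would
    contain the atom, so it would have infinite measure and the integral of [|g|] would be
    infinite. *)
Lemma integrable_infty_atom mu (g : T -> R) x : measurable [set x] ->
  mu.-integrable setT (EFin \o g) -> mu [set x] = +oo%E -> g x = 0.
Proof.
move=> mx /integrableP[mg lty] muy; apply/eqP/negPn/negP => gx0.
have gx : 0 < `|g x| by rewrite normr_gt0.
have := le_lt_trans (le_integral_abse mu measurableT mg gx) lty.
rewrite setTI /=.
suff -> : (mu [set y | (`|g x|%:E <= `|(g y)%:E|)%E] = +oo)%E.
  by rewrite gt0_muley.
apply/eqP; rewrite -leye_eq -muy; apply: le_measure; rewrite ?inE//.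
  rewrite -[X in measurable X]setTI; apply: emeasurable_fun_c_infty => //.
  exact: measurable_abse.
by move=> _ ->/=; rewrite lexx.
Qed.

Lemma ge0_integral0_ae_eq mu (g h : T -> R) :
  mu.-integrable setT (EFin \o g) -> (forall x, 0 <= g x) ->
  (\int[mu]_x (g x)%:E = 0)%E -> (forall x, g x = 0 -> h x = 0) ->
  ae_eq mu setT (EFin \o h) (cst 0%E).
Proof.
move=> /measurable_int mg g0 ig gh.
have : ae_eq mu setT (EFin \o g) (cst 0%E).
  apply/ae_eq_integral_abs => //; rewrite -[RHS]ig.
  by apply: eq_integral => x _ /=; rewrite ger0_norm.
by apply: filterS => x /= gx /gx[/gh ->].
Qed.

End IntegralsAndMeasures.

(** * The moment cone: Dirac measures, atoms, and the zeros of functions in N_+(s) *)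

Section MomentCone.
Variables (R : realType) (X : ptopologicalType).
Hypothesis X_hausdorff : hausdorff_space X.
Variables (m : nat) (E : set (X -> R)) (f : 'I_m -> X -> R).
Hypothesis E_basis : is_basis E f.
Implicit Types (s t u : 'rV[R]_m) (x : X).
Implicit Types mu nu : {measure set (borel X) -> \bar R}.

Definition eval_vector x : 'rV[R]_m := \row_j f j x.

Lemma lincombE u x : lincomb f u x = dot (eval_vector x) u.
Proof.
rewrite /lincomb fct_sumE; apply: eq_bigr => j _.
by rewrite mxE mulrC.
Qed.

Lemma lincomb_span u : E (lincomb f u).
Proof. by have [-> _] := E_basis; exists u. Qed.

Lemma basis_span j : E (f j).
Proof.
suff -> : f j = lincomb f (delta_mx 0 j) by exact: lincomb_span.
apply/funext => x; rewrite lincombE dotE trmx_delta -colE !mxE.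
by [].
Qed.

Lemma Lfun_lincomb s u : Defs.Lfun f s (lincomb f u) = dot s u.
Proof.
rewrite /Defs.Lfun (coords_lincomb _ E_basis).
by apply: eq_bigr => j _; rewrite mulrC.
Qed.

Lemma integral_lincomb s mu u : representing E f s mu ->
  (\int[mu]_x (lincomb f u x)%:E = (dot s u)%:E)%E.
Proof.
move=> [_ muE mus].
under eq_integral do rewrite lincombE -sumEFin.
rewrite integral_sum//=; last first.
  move=> j; under eq_fun do rewrite mxE mulrC EFinM.
  by apply: integrableZl => //; exact: muE (basis_span j).
rewrite -sumEFin; apply: eq_bigr => j _.
under eq_integral do rewrite mxE mulrC EFinM.
rewrite integralZl//; last exact: muE (basis_span j).
by rewrite -mus -EFinM mulrC.
Qed.

(** Integrability against a representing measure of any one point of the cone includes Borel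
    measurability. *)
Lemma moment_cone_measurable s g : moment_cone E f s -> E g ->
  measurable_fun [set: borel X] g.
Proof. by move=> [mu [_ muE _]] /muE/measurable_int/measurable_EFinP. Qed.

Lemma representing_add s t mu nu : representing E f s mu ->
  representing E f t nu -> representing E f (s + t) (measure_add mu nu).
Proof.
move=> [muR muE mus] [nuR nuE nut]; split; first exact: radon_add.
  by move=> g Eg; apply: integrable_measure_add; [exact: muE|exact: nuE].
move=> j; have fj := basis_span j; rewrite mxE EFinD mus nut.
by rewrite (integral_measure_add measurableT (muE _ fj) (nuE _ fj)).
Qed.

Lemma representing_scale (r : {nonneg R}) s mu : 0 < r%:num ->
  representing E f s mu -> representing E f (r%:num *: s) (mscale r mu).
Proof.
move=> r0 [muR muE mus]; split; first exact: radon_mscale.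
  by move=> g Eg; exact/integrable_mscale/muE.
move=> j; rewrite mxE EFinM mus integral_mscale//.
exact: (muE _ (basis_span j)).
Qed.

Lemma representing_dirac s x : moment_cone E f s ->
  representing E f (eval_vector x) (@dirac _ (borel X) x R).
Proof.
move=> sS; split; first exact: radon_dirac.
  by move=> g Eg; apply: integrable_dirac; exact: moment_cone_measurable sS Eg.
move=> j; rewrite integral_dirac//.
  by rewrite diracT mul1e mxE.
apply/measurable_EFinP; exact: moment_cone_measurable sS (basis_span j).
Qed.

Lemma moment_cone_add s t :
  moment_cone E f s -> moment_cone E f t -> moment_cone E f (s + t).
Proof.
by move=> [mu ?] [nu ?]; exists (measure_add mu nu); exact: representing_add.
Qed.

Lemma moment_cone_scale (a : R) s : 0 < a ->
  moment_cone E f s -> moment_cone E f (a *: s).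
Proof.
move=> a0 [mu ?]; exists (mscale (NngNum (ltW a0)) mu).
exact: (@representing_scale (NngNum (ltW a0))).
Qed.

Lemma moment_cone_eval s x :
  moment_cone E f s -> moment_cone E f (eval_vector x).
Proof.
move=> sS; exists (@dirac _ (borel X) x R).
exact: representing_dirac sS.
Qed.

(** Split [mu] into its restriction to the complement of [x] and [a] times the Dirac measure at [x];
    the restriction represents the difference. *)
Lemma remove_atom s mu x (a : {nonneg R}) : representing E f s mu ->
  mu [set x] = a%:num%:E -> moment_cone E f (s - a%:num *: eval_vector x).
Proof.
move=> mus mux; have [muR muE musj] := mus.
have sS : moment_cone E f s by exists mu.
have [dR dE dsj] := representing_dirac x sS.
have mx := set1_borel X_hausdorff x; have mxC := measurableC mx.
pose rest : {measure set (borel X) -> \bar R} := mrestr mu mxC.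
pose atom : {measure set (borel X) -> \bar R} :=
  mscale a (@dirac _ (borel X) x R).
have muD A : measurable A -> mu A = measure_add rest atom A.
  move=> mA; rewrite [RHS]measure_addE.
  have -> : rest A = mu (A `&` ~` [set x]) by [].
  have -> : atom A = (a%:num%:E * \d_(x : borel X) A)%E by [].
  have -> : (a%:num%:E * \d_(x : borel X) A)%E = mu (A `&` [set x]).
    rewrite diracE; have [xA|xA] := pselect (A x).
      by rewrite mem_set// mule1 -mux; congr (mu _); rewrite setIidr// => _ ->.
    rewrite memNset// mule0 -(measure0 mu); congr (mu _).
    by apply/esym/disjoints_subset => y Ay /= yx; apply: xA; rewrite -yx.
  rewrite -measureU//; [|exact: measurableI|exact: measurableI|].
    by rewrite -setIUr setUC setUv setIT.
  by rewrite setIACA setICl setI0.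
have integralD g : (\int[mu]_x g x = \int[measure_add rest atom]_x g x)%E.
  by apply: eq_measure_integral => A mA _; exact: muD.
have addE g : E g -> (measure_add rest atom).-integrable setT (EFin \o g).
  move=> Eg; have /integrableP[mg lty] := muE g Eg.
  by apply/integrableP; split=> //; rewrite -integralD.
have restE g : E g -> rest.-integrable setT (EFin \o g).
  by move=> /addE/integrable_measure_addl.
exists rest; split; [exact: radon_mrestr|exact: restE|move=> j].
have fj := basis_span j.
have : (s 0 j)%:E = ((\int[rest]_x (f j x)%:E) + (a%:num * f j x)%:E)%E.
  rewrite musj integralD integral_measure_add//; first last.
  - exact/integrable_mscale/dE.
  - exact: restE.
  by rewrite integral_mscale ?dE// -dsj mxE EFinM.
by move=> sj; rewrite !mxE EFinB sj addeK.
Qed.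

Lemma atom_absorbed s mu x : representing E f s mu -> (0 < mu [set x])%E ->
  exists2 e : R, 0 < e & moment_cone E f (s - e *: eval_vector x).
Proof.
move=> mus; have := remove_atom (x := x) mus.
case mux : (mu [set x]) => [a| |] // rm a0.
  by exists a => //; exact: (rm (NngNum (ltW a0))).
(* At an atom of infinite mass every integrable function vanishes, so the moment vector is zero and
   any [e] would do. *)
exists 1 => //; suff -> : eval_vector x = 0 by rewrite scaler0 subr0; exists mu.
apply/rowP => j; rewrite !mxE; have [_ muE _] := mus.
apply: (integrable_infty_atom (set1_borel X_hausdorff x)) mux.
exact: muE (basis_span j).
Qed.

(** A function in N_+(s) has integral zero against each representing measure, so the points where it
    is positive lie in a null set, which cannot contain an atom. *)
Lemma atoms_sub_V_plus s : atoms E f s `<=` V_plus E f s.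
Proof.
move=> x [mu mus mux] g [[Eg g0] Lg].
have [_ muE _] := mus; have [EE _] := E_basis.
have [u _ gE] : range (lincomb f) g by rewrite -EE.
have ig : (\int[mu]_x (g x)%:E = 0)%E.
  by rewrite -gE (integral_lincomb _ mus) -(Lfun_lincomb s u) gE Lg.
have [N [mN N0 gN]] := ge0_integral0_ae_eq (muE g Eg) g0 ig (fun _ => id).
apply/eqP/negPn/negP => gx0; move: mux.
rewrite lt_neqAle => /andP[/negP + _]; apply.
rewrite eq_sym -measure_le0 -N0; apply: le_measure; rewrite ?inE//.
  exact: set1_borel.
by move=> _ ->; apply: gN => /(_ I)[] /eqP; rewrite (negbTE gx0).
Qed.

Lemma N_plusP s u : N_plus E f s (lincomb f u) <->
  (forall x, 0 <= dot (eval_vector x) u) /\ dot s u = 0.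
Proof.
rewrite /N_plus /nonneg_part /= Lfun_lincomb.
split=> [[[_ u0] su]|[u0 su]]; split=> //; last split.
- by move=> x; rewrite -lincombE.
- exact: lincomb_span.
- by move=> x; rewrite lincombE.
Qed.

Lemma dot_moment_cone_ge0 t u : moment_cone E f t ->
  (forall x, 0 <= dot (eval_vector x) u) -> 0 <= dot t u.
Proof.
move=> [mu mut] u0; rewrite -lee_fin -(integral_lincomb u mut).
by apply: integral_ge0 => x _; rewrite lincombE lee_fin.
Qed.

Lemma V_plus_zero_set s : exists2 u, N_plus E f s (lincomb f u) &
  V_plus E f s = [set x | dot (eval_vector x) u = 0].
Proof.
have [n [M [NM spanM]]] :=
  finite_spanning_family [set u | N_plus E f s (lincomb f u)].
pose u := \sum_i row i M.
have dotu t : dot t u = \sum_i dot t (row i M).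
  by rewrite dotC dot_suml; apply: eq_bigr => i _; rewrite dotC.
have Nu : N_plus E f s (lincomb f u).
  apply/N_plusP; split=> [x|]; rewrite dotu.
    by apply: sumr_ge0 => i _; have /N_plusP[] := NM i.
  by rewrite big1// => i _; have /N_plusP[] := NM i.
exists u => //; apply/seteqP; split=> x /=.
  by move=> /(_ _ Nu); rewrite lincombE.
rewrite dotu => xu g Ng; have [EE _] := E_basis.
have [c _ gc] : range (lincomb f) g by rewrite -EE; exact: Ng.1.1.
have /spanM/submxP[a ca] : N_plus E f s (lincomb f c) by rewrite gc.
(* A vanishing sum of nonnegative terms has only zero terms, so a zero of f_u is a zero of the whole
   spanning family, hence of all of N_+(s). *)
have row0 i : dot (eval_vector x) (row i M) = 0.
  apply: (psumr_eq0P _ xu) => // j _.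
  by have /N_plusP[] := NM j.
rewrite -gc lincombE ca mulmx_sum_row dotC dot_suml big1// => i _.
by rewrite dotZl dotC row0 mulr0.
Qed.

(** By [dot_separates], take [v] orthogonal to the rows of [M]. Then f_v vanishes wherever f_u does,
    hence almost everywhere for a measure representing [t], and integrating gives [dot t v = 0]. *)
Lemma face_sub_span s u n (M : 'M[R]_(n, m)) t :
  N_plus E f s (lincomb f u) ->
  (forall x, dot (eval_vector x) u = 0 -> (eval_vector x <= M)%MS) ->
  moment_cone E f t -> dot t u = 0 -> (t <= M)%MS.
Proof.
move=> /N_plusP[u0 _] uM [mu mut] tu; apply: dot_separates => v Mv.
have [_ muE _] := mut.
apply: EFin_inj; rewrite -(integral_lincomb v mut).
rewrite (ae_eq_integral (cst 0%E)) ?integral0//.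
- exact: measurable_int (muE _ (lincomb_span v)).
- apply: (@ge0_integral0_ae_eq _ (borel X) _ mu (lincomb f u) (lincomb f v)).
  + exact: muE (lincomb_span u).
  + by move=> x; rewrite lincombE.
  + by rewrite (integral_lincomb u mut) tu.
  + move=> x; rewrite !lincombE => /uM/submxP[c ->].
    rewrite mulmx_sum_row dot_suml big1// => i _.
    by rewrite dotZl Mv mulr0.
Qed.

(** Solving for [s] makes it [(1 + e)^-1] times the sum of the prolonged point and [e] times the
    moment vector of [x]; the matching measure has mass at least [e / (1 + e)] at [x]. *)
Lemma atoms_of_extension s x (e : R) : 0 < e ->
  moment_cone E f (s + e *: (s - eval_vector x)) -> atoms E f s x.
Proof.
move=> e0 extS; have [nu nuS] := extS.
have e1 : 0 < (1 + e)^-1 by rewrite invr_gt0 addr_gt0.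
pose e' := NngNum (ltW e0); pose d' := NngNum (ltW e1).
have xS := representing_dirac x extS.
exists (mscale d' (measure_add nu (mscale e' (@dirac _ (borel X) x R)))).
  have -> : s = d'%:num *:
      (s + e *: (s - eval_vector x) + e'%:num *: eval_vector x).
    rewrite scalerBr -addrA subrK -[X in X + _]scale1r -scalerDl scalerA.
    by rewrite mulVf ?scale1r// gt_eqF// addr_gt0.
  apply: representing_scale => //; apply: representing_add => //.
  exact: representing_scale.
apply: mule_gt0; first by rewrite lte_fin.
rewrite [ltRHS]measure_addE.
have dx : (0 < mscale e' (@dirac _ (borel X) x R) [set x])%E.
  by rewrite [ltRHS]/mscale /= diracE mem_set// mule1 lte_fin.
by apply: lt_le_trans dx _; rewrite leeDr.
Qed.

End MomentCone.

Theorem theorem29 (R : realType) (X : ptopologicalType)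
    (X_lc : locally_compact [set: X]) (X_hausdorff : hausdorff_space X)
    (m : nat) (E : set (X -> R)) (f : 'I_m -> X -> R)
    (E_cont : forall g : X -> R, E g -> continuous g)
    (E_basis : is_basis E f)
    (s : 'rV[R]_m) (sS : moment_cone E f s)
    (s_bd : boundary (moment_cone E f) s) :
  V_plus E f s = atoms E f s <->
  exists F : set 'rV[R]_m,
    exposed_face (moment_cone E f) F /\ relative_interior F s.
Proof.
set S := moment_cone E f.
split=> [VW|[F [faceF sF]]]; last first.
  apply/seteqP; split=> [x Vx|]; last exact: atoms_sub_V_plus.
  have [xF FS] : F (eval_vector f x) /\ F `<=` S.
    have xS : S (eval_vector f x) by exact: moment_cone_eval sS.
    case: faceF => [->|F0|[u [t [[_ _ _ u0] FE]]]].
    - by split.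
    - by move: sF; rewrite F0 => -[].
    rewrite FE; split; last exact: subIsetr.
    (* Since [u] is nonnegative on all moment vectors and orthogonal to [s], f_u lies in N_+(s) and
       so vanishes at [x]. *)
    split=> //; rewrite /hyperplane /= -lincombE; apply: Vx.
    apply/(N_plusP E_basis); split=> [y|].
      by apply: u0; exact: moment_cone_eval sS.
    by move: sF; rewrite FE => -[[]].
  have [e e0 /FS] := relative_interior_absorb sF xF.
  exact: atoms_of_extension.
have [u Nu Vu] := V_plus_zero_set E_basis s.
have [u0 su] := (N_plusP E_basis s u).1 Nu.
exists (hyperplane u `&` S); split.
  have [->|uN0] := eqVneq u 0.
    apply: Or31; rewrite (_ : hyperplane 0 = setT) ?setTI//.
    apply/seteqP; split=> // t _.
    by rewrite /hyperplane /= -(scale0r 0) dotC dotZl mul0r.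
  apply: Or33; exists u, s; split=> //; split=> // t tS.
  exact: dot_moment_cone_ge0 tS u0.
(* The rows of [M] are finitely many moment vectors of points of V_+(s), spanning all the others. *)
have [n [M [MV spanM]]] :=
  finite_spanning_family [set eval_vector f x | x in V_plus E f s].
apply: (relative_interior_face _ _ (M := M)) => //.
- by move=> t t'; exact: moment_cone_add.
- by move=> a t; exact: moment_cone_scale.
- by move=> i; have [x _ <-] := MV i; exact: moment_cone_eval sS.
(* Here the assumed equality enters: each row comes from an atom of a measure representing [s]. *)
- move=> i; have [x + <-] := MV i; rewrite VW => -[mu mus mux].
  exact: (atom_absorbed X_hausdorff E_basis mus mux).
- move=> t tS tu; apply: (face_sub_span E_basis Nu _ tS tu) => x xu.
  by apply: spanM; exists x => //; rewrite Vu.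
Qed.
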